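(* Let $k\in\mathfrak m_{\mathsf I}$. The solution $M$ of the left half-shuffle fixed point equation $$M=\varepsilon+k\prec M$$ lies in $\mathsf M_{\mathsf I}$ and satisfies, for every translucent word $t$ and every incomplete word $w\in\mathcal W(t)$, $$M(w)=\sum_{\pi\in\mathcal{NC}_{|}(t)}\ \prod_{V\in\pi}k(w|_V),$$ where $\mathcal{NC}_{|}(t)$ is the set of shaded noncrossing bipartitions of type $t$.
   Context: Write $\llbracket n\rrbracket=\{1,\dots,n\}$; $A\subset B$ allows equality. For a word $w$ of length $|w|$ and $A=\{i_1<\dots<i_p\}\subset\llbracket|w|\rrbracket$, $w|_A=w(i_1)\cdots w(i_p)$. Translucent words. A translucent word is a pair $t=(\alpha_t,b_t)$ of words of equal length $|t|\ge0$, $\alpha_t\in\{\mathsf L,\mathsf R\}^\star$, $b_t\in\{0,1\}^\star$. Put $[t]_0=\{i:b_t(i)=0\}$, $[t]_1=\{i:b_t(i)=1\}$, $t(i)=(\alpha_t(i),b_t(i))$. The necklace order $\lessdot$ on $\llbracket|t|\rrbracket$ is the total order in which all $\mathsf L$-positions (those with $\alpha_t(i)=\mathsf L$) precede all $\mathsf R$-positions, the $\mathsf L$-positions being ordered increasingly and the $\mathsf R$-positions decreasingly. For nonempty $A$, $\dot\bigwedge A$ is its $\lessdot$-minimum. $\mathrm{int}(t)$ is the set of maximal (nonempty) intervals of $(\llbracket|t|\rrbracket,\lessdot)$ contained in $[t]_1$. Incomplete words. Fix finite sets $\dot S^{\mathsf L},\dot S^{\mathsf R}$ of left and right random variables (finite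 subsets of two subalgebras of a unital complex algebra, treated as disjoint and disjoint from the placeholder symbols $\mathsf L,\mathsf R$). Put $S^{(\mathsf L,0)}=\{\mathsf L\}$, $S^{(\mathsf R,0)}=\{\mathsf R\}$, $S^{(\mathsf L,1)}=\dot S^{\mathsf L}$, $S^{(\mathsf R,1)}=\dot S^{\mathsf R}$, and $\mathcal W(t)=S^{t(1)}\times\cdots\times S^{t(|t|)}$; elements are incomplete words of type $t$. For $w\in\mathcal W(t)$ put $[w]_i=[t]_i$, $\mathrm{int}(w)=\mathrm{int}(t)$; the translucidation $w_{I\leadsto0}$ ($I\subset\llbracket|w|\rrbracket$) is obtained by replacing $w(j)$ by the placeholder $\alpha_t(j)$ for every $j\in I$. $\mathcal W$ is the collection of all incomplete words. A linear form on $\mathbb C\mathcal W$ is a linear functional on $\bigoplus_t\mathbb C\mathcal W(t)$, i.e. is given by arbitrary values on incomplete words. Half-shuffle product. $\varepsilon(w)=1$ if $w\in\{\mathsf L,\mathsf R\}^\star$ (only placeholders), $\varepsilon(w)=0$ otherwise. $\mathfrak g$ is the space of linear forms vanishing on $\{\mathsf L,\mathsf R\}^\star$. For $f,g\in\mathfrak g$, $f\prec g\in\mathfrak g$ is $$(f\prec g)(w)=\sum_{\substack{[w]_0\subsetneq I\subsetneq\llbracket|w|\rrbracket\\ \dot\bigwedge[w]_1\in I}}f(w|_I)\,g(w_{I\leadsto0})\qquad([w]_1\neq\varnothing),$$ and $f\prec\varepsilon=f$; so for $M$ with $M-\varepsilon\in\mathfrak g$, $k\prec M=k+k\prec(M-\varepsilon)$.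 $\mathsf M_{\mathsf I}$ is the set of linear forms $f$ on $\mathbb C\mathcal W$ with $f(w)=\prod_{J\in\mathrm{int}(w)}f(w|_J)$ for all $w\in\mathcal W$ (empty product $=1$). $\mathfrak m_{\mathsf I}$ is the set of linear forms $f$ on $\mathbb C\mathcal W$ such that $f(w)=0$ whenever $|\mathrm{int}(w)|\ne1$, and $f(w)=f(w|_{[w]_1})$ whenever $|\mathrm{int}(w)|=1$. Partitions. An incomplete noncrossing bipartition of type $t$ is a set partition $\pi$ of $[t]_1$ such that $\pi$ together with the additional block $[t]_0$ (if nonempty) is a noncrossing partition of $(\llbracket|t|\rrbracket,\lessdot)$: there are no $a\lessdot b\lessdot c\lessdot d$ with $a,c$ in one block and $b,d$ in another block. Such $\pi$ is a shaded noncrossing bipartition of type $t$ if for every $1\le k<\min[t]_0$ with $\alpha_t(k)=\alpha_t(\min[t]_0)$, every $j$ in the same block of $\pi$ as $k$ satisfies $j<\min[t]_0$ and $\alpha_t(j)=\alpha_t(\min[t]_0)$ ($\min$ is for the natural order; no condition if $[t]_0=\varnothing$). *)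

(* Defs.v *)
From HB Require Import structures.
From mathcomp Require Import all_boot all_order all_algebra.

Set Implicit Arguments.
Unset Strict Implicit.
Unset Printing Implicit Defensive.

Import GRing.Theory.
Local Open Scope ring_scope.

Variant side := Left | Right.

Definition bool_of_side (s : side) : bool := if s is Left then true else false.
Definition side_of_bool (b : bool) : side := if b then Left else Right.

Lemma bool_of_sideK : cancel bool_of_side side_of_bool.
Proof. by case. Qed.

HB.instance Definition _ := Equality.copy side (can_type bool_of_sideK).

(* A pair of words of equal length is encoded as the word of the pairs        *)
(* t(i) = (alpha_t(i), b_t(i)); the bit 1 is [true]. Positions are counted    *)
(* from 0.                                                                    *)
Definition translucent_word := seq (side * bool).

Section TranslucentWords.

Variable t : translucent_word.
Implicit Types (i j m : 'I_(size t)) (A J V : {set 'I_(size t)}).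
Implicit Types pi P : {set {set 'I_(size t)}}.

Definition alpha i : side := (tnth (in_tuple t) i).1.
Definition bit i : bool := (tnth (in_tuple t) i).2.

Definition zeros : {set 'I_(size t)} := [set i | ~~ bit i].
Definition ones : {set 'I_(size t)} := [set i | bit i].

Definition necklace_lt i j : bool :=
  match alpha i, alpha j with
  | Left, Left => (i < j)%N
  | Left, Right => true
  | Right, Left => false
  | Right, Right => (j < i)%N
  end.

Definition is_necklace_min A i : bool :=
  (i \in A) && [forall j in A, (j == i) || necklace_lt i j].

Definition necklace_interval J : bool :=
  [forall a in J, forall b in J, forall i,
    (necklace_lt a i && necklace_lt i b) ==> (i \in J)].

Definition int_tw : {set {set 'I_(size t)}} :=
  [set J | maxset (fun J' : {set 'I_(size t)} =>
    [&& J' != set0, necklace_interval J' & J' \subset ones]) J].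

Definition necklace_noncrossing P : bool :=
  [forall B in P, forall B' in P, (B != B') ==>
    [forall a in B, forall b in B', forall c in B, forall d in B',
      ~~ [&& necklace_lt a b, necklace_lt b c & necklace_lt c d]]].

Definition incomplete_nc_bipartition pi : bool :=
  partition pi ones &&
  necklace_noncrossing (if zeros == set0 then pi else zeros |: pi).

Definition is_min_zero m : bool :=
  (m \in zeros) && [forall j in zeros, (m <= j)%N].

(* Every k < min [t]_0 lies in [t]_1, so [pblock pi k] is its block in pi. *)
Definition shaded pi : bool :=
  [forall m, is_min_zero m ==>
    [forall k : 'I_(size t), (k < m)%N && (alpha k == alpha m) ==>
      [forall j in pblock pi k, (j < m)%N && (alpha j == alpha m)]]].

Definition shaded_nc_bipartitions : {set {set {set 'I_(size t)}}} :=
  [set pi | incomplete_nc_bipartition pi && shaded pi].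

End TranslucentWords.

Section Words.

Variable n : nat.
Implicit Types A I : {set 'I_n}.

Definition indicator A : bitseq := [seq i \in A | i <- enum 'I_n].

(* w|_A for a word w of length n; keeping n separate from [size w] lets A be  *)
(* a set of positions of w or of its type.                                    *)
Definition subword (T : Type) A (w : seq T) : seq T := mask (indicator A) w.

End Words.

Section IncompleteWords.

(* The letters: the placeholders and two disjoint copies of SL and SR. *)
Variables SL SR : Type.

Variant letter : Type :=
  | Placeholder of side
  | LeftVar of SL
  | RightVar of SR.

Definition letter_type (x : letter) : side * bool :=
  match x with
  | Placeholder s => (s, false)
  | LeftVar _ => (Left, true)
  | RightVar _ => (Right, true)
  end.

Definition incomplete_word := seq letter.

(* A letter determines its type, so w belongs to W(t) for exactly one t,      *)
(* namely [word_type w].                                                      *)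
Definition word_type (w : incomplete_word) : translucent_word :=
  [seq letter_type x | x <- w].

Definition positions (w : incomplete_word) := 'I_(size (word_type w)).

Definition word_zeros w : {set positions w} := zeros (word_type w).
Definition word_ones w : {set positions w} := ones (word_type w).
Definition int_w w : {set {set positions w}} := int_tw (word_type w).

Definition translucidate n (I : {set 'I_n}) (w : incomplete_word) :
    incomplete_word :=
  [seq (if p.1 then Placeholder (letter_type p.2).1 else p.2)
     | p <- zip (indicator I) w].

Definition placeholder_word (w : incomplete_word) : bool :=
  all (fun x => ~~ (letter_type x).2) w.

Section LinearForms.

Variable K : comNzRingType.

(* A linear form on the free K-module on incomplete words is given by its     *)
(* values on the words.                                                       *)
Definition linear_form := incomplete_word -> K.
Implicit Types f g k M : linear_form.

Definition epsilon : linear_form := fun w => (placeholder_word w)%:R.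

Definition in_g f : Prop := forall w, placeholder_word w -> f w = 0.

(* On placeholder words no I satisfies the conditions and the value is 0. *)
Definition half_shuffle f g : linear_form := fun w =>
  \sum_(I : {set positions w} |
          [&& word_zeros w \proper I, I \proper [set: positions w]
            & [exists i in I, is_necklace_min (word_ones w) i]])
    f (subword I w) * g (translucidate I w).

(* Extension of the product by f < epsilon = f, additively on the right, to   *)
(* those M with M - epsilon in g.                                             *)
Definition half_shuffle_unital f M : linear_form := fun w =>
  f w + half_shuffle f (fun v => M v - epsilon v) w.

Definition half_shuffle_solution k M : Prop :=
  in_g (fun w => M w - epsilon w) /\
  forall w, M w = epsilon w + half_shuffle_unital k M w.

Definition in_MI f : Prop :=
  forall w, f w = \prod_(J in int_w w) f (subword J w).

Definition in_mI f : Prop :=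
  (forall w, #|int_w w| <> 1%N -> f w = 0) /\
  (forall w, #|int_w w| = 1%N -> f w = f (subword (word_ones w) w)).

End LinearForms.

End IncompleteWords.

(* Main.v *)
Require Import Defs.
From mathcomp Require Import all_boot all_order all_algebra.
From mathcomp Require Import finmap reals complex.

Set Implicit Arguments.
Unset Strict Implicit.
Unset Printing Implicit Defensive.

Import GRing.Theory.
Local Open Scope ring_scope.

(** The equation [M = epsilon + k < M] determines M(w) from the values of M on
words with fewer variables. A term of the half-shuffle at I involves
k(w|_I), and since k lies in m_I this value vanishes unless the variables
V of w in I form an interval of I, in which case it equals k(w|_V). As I
contains all placeholders of w, the condition says that no placeholder lies
between two elements of V in the necklace order. Hence, with m the
necklace-minimum of the variables of w,
    M(w) = sum over V of k(w|_V) M(w with V turned into placeholders),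
V ranging over the sets of variables that contain m and have no placeholder in
their hull.

The same recursion holds for a sum over partitions. For a finite totally
ordered set T and a subset A, let nc(A) be the sum, over the noncrossing
partitions of A whose blocks have their hull contained in A, of the product of
the weights of the blocks. Removing the block of the minimum of A gives the
recursion ([nc_sum_rec]): the other blocks cannot enclose a point of the
removed block without crossing it. So M(w) is nc(variables of w)
([moment_half_shuffle]); uniqueness is an induction on the number of variables.

Two facts about nc conclude. First, the partitions summed over are exactly the
shaded noncrossing bipartitions ([shaded_nc_bipartitionsE]): noncrossing with
the block of placeholders, a block can only leave its interval by joining the
interval before all placeholders to the one after all of them, and one of
these two consists of the positions k constrained by shadedness. Secondly, nc
is multiplicative over the maximal intervals of A ([nc_sum_intervals]), by
induction through the recursion, which gives M in M_I.

Each word has its own type of positions, so restricting or translucidating a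
word changes the ordered set; [nc_sum_transport] moves nc along an increasing
injection with convex range. *)

(** * Noncrossing partitions of subsets of a totally ordered finite set *)

(** A strict total order, as a boolean relation; on positions it is the necklace
order. *)
Definition strict_total (T : finType) (lt : rel T) : Prop :=
  [/\ irreflexive lt, transitive lt & forall x y, x != y -> lt x y || lt y x].

Section Order.

Variables (T : finType) (lt : rel T).
Implicit Types (A B J V : {set T}) (pi P : {set {set T}}).

(** [m] is the minimum of [A]. With the necklace order, this and the definitions
[noncrossing] and [intervals] below are convertible to [is_necklace_min],
[necklace_noncrossing] and [int_tw]. *)
Definition is_min A m : bool :=
  (m \in A) && [forall j in A, (j == m) || lt m j].

(** The convex hull of [V] is contained in [A], as soon as [V] is. *)
Definition hull_in A V : bool :=
  [forall a in V, forall c in V, forall b, (lt a b && lt b c) ==> (b \in A)].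

(** No two distinct blocks of [P] interlace. *)
Definition noncrossing P : bool :=
  [forall B in P, forall B' in P, (B != B') ==>
    [forall a in B, forall b in B', forall c in B, forall d in B',
      ~~ [&& lt a b, lt b c & lt c d]]].

(** The noncrossing partitions of [A] each of whose blocks lies in a single
maximal interval of [A]. *)
Definition interval_nc A : {set {set {set T}}} :=
  [set pi | [&& partition pi A, noncrossing pi
              & [forall V in pi, hull_in A V]]].

(** The maximal nonempty intervals contained in [A]. *)
Definition intervals A : {set {set T}} :=
  [set J | maxset (fun J' : {set T} =>
    [&& J' != set0, hull_in J' J' & J' \subset A]) J].

(** Everything strictly between [x] and [y] lies in [A]; for [x] and [y] in [A]
this says that they belong to the same maximal interval of [A]. *)
Definition connected_in A x y : bool :=
  [forall z, (lt x z && lt z y || lt y z && lt z x) ==> (z \in A)].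

(** Between a point of [A] and a point of [B] there is always a point outside
both, so no interval contained in the union meets both. *)
Definition separated A B : Prop := forall a b, a \in A -> b \in B ->
  exists2 z, z \notin A :|: B & lt a z && lt z b || lt b z && lt z a.

Lemma hull_inP A V :
  reflect (forall a c b, a \in V -> c \in V -> lt a b -> lt b c -> b \in A)
          (hull_in A V).
Proof.
apply: (iffP idP) => [h a c b aV cV ab bc | h].
  have /forall_inP/(_ c cV)/forallP/(_ b) := forall_inP h a aV.
  by rewrite ab bc.
apply/forall_inP => a aV; apply/forall_inP => c cV; apply/forallP => b.
by apply/implyP => /andP[ab bc]; apply: (h a c).
Qed.

Lemma noncrossingP P :
  reflect (forall B B' a b c d, B \in P -> B' \in P -> B != B' ->
     a \in B -> b \in B' -> c \in B -> d \in B' ->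
     lt a b -> lt b c -> lt c d -> False)
   (noncrossing P).
Proof.
apply: (iffP idP) => [h B B' a b c d BP B'P neq aB bB' cB dB' ab bc cd | h].
  move: h => /forall_inP/(_ B BP)/forall_inP/(_ B' B'P)/implyP/(_ neq).
  move=> /forall_inP/(_ a aB)/forall_inP/(_ b bB')/forall_inP/(_ c cB).
  by move=> /forall_inP/(_ d dB'); rewrite ab bc cd.
apply/forall_inP => B BP; apply/forall_inP => B' B'P; apply/implyP => neq.
apply/forall_inP => a aB; apply/forall_inP => b bB'; apply/forall_inP => c cB.
apply/forall_inP => d dB'; apply/negP => /and3P[ab bc cd].
exact: (h B B' a b c d).
Qed.

Lemma connected_inP A x y :
  reflect (forall z, lt x z && lt z y || lt y z && lt z x -> z \in A)
          (connected_in A x y).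
Proof. by apply: (iffP forallP) => h z; apply/implyP/h. Qed.

Lemma connected_inC A x y : connected_in A x y = connected_in A y x.
Proof.
by apply/connected_inP/connected_inP => h z zb; apply: h; rewrite orbC.
Qed.

Lemma hull_in_connected A V x y :
  hull_in A V -> x \in V -> y \in V -> connected_in A x y.
Proof.
move=> /hull_inP h xV yV; apply/connected_inP => z.
by case/orP=> /andP[]; apply: h.
Qed.

Hypothesis lt_tot : strict_total lt.

Lemma slt_irr x : lt x x = false.
Proof. by case: lt_tot => h _ _; apply: h. Qed.

Lemma slt_trans y x z : lt x y -> lt y z -> lt x z.
Proof. by case: lt_tot => _ h _; apply: h. Qed.

Lemma slt_total x y : [\/ x = y, lt x y | lt y x].
Proof.
case: (eqVneq x y) => [|ne]; first by constructor 1.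
by case: lt_tot => _ _ /(_ x y ne)/orP[]; [constructor 2 | constructor 3].
Qed.

Lemma is_minP A m : is_min A m ->
  m \in A /\ forall j, j \in A -> j != m -> lt m j.
Proof.
case/andP=> mA /forall_inP h; split=> // j jA jm.
by have := h j jA; rewrite (negPf jm).
Qed.

Lemma is_min_unique A m m' : is_min A m -> is_min A m' -> m = m'.
Proof.
move=> /is_minP[mA hm] /is_minP[m'A hm']; apply/eqP/negPn/negP => ne.
have h1 := hm' m mA ne; rewrite eq_sym in ne.
by have := slt_trans h1 (hm m' m'A ne); rewrite slt_irr.
Qed.

Lemma is_min_exists A : A != set0 -> exists m, is_min A m.
Proof.
case/set0Pn=> x xA.
(* a point with the fewest predecessors *)
case: (arg_minnP (fun y => #|[set z | lt z y]|) xA) => m mA hm.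
exists m; apply/andP; split=> //; apply/forall_inP => j jA.
case: (slt_total j m) => [->|jm|->]; rewrite ?eqxx ?orbT //.
have := hm j jA; rewrite leqNgt proper_card //.
apply/properP; split; last by exists j; rewrite !inE ?slt_irr.
by apply/subsetP => z; rewrite !inE => zj; apply: slt_trans jm.
Qed.

Lemma connected_in_equivalence A :
  {in A & &, equivalence_rel (connected_in A)}.
Proof.
have tr x y z : y \in A -> connected_in A x y -> connected_in A y z ->
    connected_in A x z.
  move=> yA /connected_inP xy /connected_inP yz; apply/connected_inP => u.
  case: (slt_total u y) => [-> //|uy|yu] /orP[]/andP[h1 h2].
  - by apply: xy; rewrite h1 uy.
  - by apply: yz; rewrite h1 uy orbT.
  - by apply: yz; rewrite h2 yu.
  - by apply: xy; rewrite h2 yu orbT.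
move=> x y z xA yA zA; split.
  apply/connected_inP => u; rewrite orbb => /andP[xu ux].
  by have := slt_trans xu ux; rewrite slt_irr.
move=> xy; apply/idP/idP => h; last exact: tr h.
by apply: tr h => //; rewrite connected_inC.
Qed.

Lemma intervalsE A : intervals A = equivalence_partition (connected_in A) A.
Proof.
have eqR := connected_in_equivalence (A := A).
pose comp x := [set y in A | connected_in A x y].
have compP x : x \in A ->
    [&& comp x != set0, hull_in (comp x) (comp x) & comp x \subset A].
  move=> xA; apply/and3P; split.
  - by apply/set0Pn; exists x; rewrite inE xA (eqR x x x xA xA xA).1.
  - apply/hull_inP => a c b; rewrite !inE => /andP[aA xa] /andP[cA xc] ab bc.
    have ac : connected_in A a c by rewrite -((eqR _ _ _ xA aA cA).2 xa).
    have bA : b \in A by apply: (connected_inP _ _ _ ac); rewrite ab bc.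
    rewrite bA ((eqR _ _ _ xA aA bA).2 xa); apply/connected_inP => z.
    case/orP=> /andP[h1 h2]; apply: (connected_inP _ _ _ ac).
      by rewrite h1 (slt_trans h2).
    by have := slt_trans (slt_trans ab h1) h2; rewrite slt_irr.
  - by apply/subsetP => y; rewrite inE => /andP[].
have sub J x : x \in J -> hull_in J J -> J \subset A -> J \subset comp x.
  move=> xJ /hull_inP hJ JA; apply/subsetP => y yJ.
  rewrite inE (subsetP JA) //=; apply/connected_inP => z zb.
  by apply: (subsetP JA); case/orP: zb => /andP[]; apply: hJ.
apply/setP => J; rewrite inE; apply/idP/imsetP => [/maxsetP[] | [x xA ->]].
  case/and3P=> /set0Pn[x xJ] hJ JA mJ; exists x; first exact: (subsetP JA).
  by rewrite -(mJ (comp x)) ?compP ?sub // (subsetP JA).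
apply/maxsetP; split; first exact: compP.
move=> B /and3P[_ hB BA] sB; apply/eqP; rewrite eqEsubset sB andbT sub //.
by apply: (subsetP sB); rewrite inE xA (eqR x x x xA xA xA).1.
Qed.

Lemma intervals_partition A : partition (intervals A) A.
Proof.
by rewrite intervalsE; apply/equivalence_partitionP/connected_in_equivalence.
Qed.

Lemma intervals_connected A J J' a b :
  J \in intervals A -> J' \in intervals A ->
  a \in J -> b \in J' -> connected_in A a b -> J = J'.
Proof.
have eqR := connected_in_equivalence (A := A).
rewrite intervalsE => /imsetP[x xA ->] /imsetP[y yA ->].
rewrite !inE => /andP[aA xa] /andP[bA yb] ab.
apply/setP => u; rewrite !inE; case uA: (u \in A) => //=.
rewrite (eqR _ _ _ xA aA uA).2 // (eqR _ _ _ aA bA uA).2 //.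
by rewrite (eqR _ _ _ yA bA uA).2.
Qed.

Lemma card_intervals1 A : (#|intervals A| == 1%N) = (A != set0) && hull_in A A.
Proof.
have pA := intervals_partition A.
have cov : cover (intervals A) = A by apply: cover_partition pA.
apply/cards1P/andP => [[J eJ] | [A0 hA]].
  have JA : J = A by rewrite -cov eJ /cover big_set1.
  have : J \in intervals A by rewrite eJ inE.
  by rewrite inE JA => /maxsetp /and3P[].
have AI : A \in intervals A.
  rewrite inE; apply/maxsetP; rewrite A0 hA subxx; split=> // B.
  by case/and3P=> _ _ BA AB; apply/eqP; rewrite eqEsubset BA.
exists A; apply/setP => J; rewrite inE; apply/idP/eqP => [JI | -> //].
case/set0Pn: A0 => b bA.
have /set0Pn[a aJ] : J != set0.
  by case/and3P: pA => _ _; apply: contra => /eqP<-.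
apply: (intervals_connected JI AI aJ bA).
apply: (hull_in_connected hA) => //.
by rewrite -cov; apply/bigcupP; exists J.
Qed.

Section Sum.

Variables (K : comNzRingType) (kappa : {set T} -> K).

(** The sum over the partitions in [interval_nc A] of the product of the weights
[kappa] of the blocks. *)
Definition nc_sum A : K := \sum_(pi in interval_nc A) \prod_(V in pi) kappa V.

Lemma nc_sum0 : nc_sum set0 = 1.
Proof.
rewrite /nc_sum (big_pred1 set0) ?big_set0 // => pi.
rewrite inE partition_set0 /=; case: eqP => //= ->.
apply/andP; split; last by apply/forall_inP => V; rewrite inE.
by apply/noncrossingP => B; rewrite inE.
Qed.

(** Decomposition according to the block [V] of the minimum of [A]. *)
Lemma nc_sum_rec A m : is_min A m -> nc_sum A =
  \sum_(V : {set T} | [&& m \in V, V \subset A & hull_in A V])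
    kappa V * nc_sum (A :\: V).
Proof.
move=> /is_minP[mA hm].
rewrite /nc_sum (partition_big (fun pi : {set {set T}} => pblock pi m)
  (fun V : {set T} => [&& m \in V, V \subset A & hull_in A V])) /=; last first.
  move=> pi; rewrite inE => /and3P[pA _ /forall_inP hpi].
  have mcov : m \in cover pi by rewrite (cover_partition pA).
  have Vpi : pblock pi m \in pi by rewrite pblock_mem.
  rewrite mem_pblock mcov hpi // andbT /=.
  apply/subsetP => x xV; rewrite -(cover_partition pA); apply/bigcupP.
  by exists (pblock pi m).
apply: eq_bigr => V /and3P[mV VA hV].
have V0 : V != set0 by apply/set0Pn; exists m.
have notin pi : partition pi (A :\: V) -> V \notin pi.
  move=> pA; apply/negP => Vpi.
  have : m \in cover pi by apply/bigcupP; exists V.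
  by rewrite (cover_partition pA) inE mV.
rewrite big_distrr /=.
rewrite (reindex_onto (fun pi : {set {set T}} => V |: pi)
    (fun pi : {set {set T}} => pi :\ V)) /=; last first.
  move=> pi /andP[]; rewrite inE => /and3P[pA _ _] /eqP eV.
  by rewrite setD1K // -eV pblock_mem // (cover_partition pA).
apply: eq_big => [pi | pi]; last first.
  case/andP=> _ /eqP e; have Vpi : V \notin pi by rewrite -e !inE eqxx.
  by rewrite big_setU1.
apply/idP/idP.
  case/andP=> /andP[]; rewrite inE => /and3P[pA ncr /forall_inP hpi] _ /eqP e.
  have Vpi : V \in V |: pi by rewrite setU11.
  rewrite -e inE partitionD1 //=; apply/andP; split.
    apply/noncrossingP => B B' a b c d /setD1P[_ h1] /setD1P[_ h2].
    exact: (noncrossingP _ ncr).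
  apply/forall_inP => W /setD1P[WV Wpi]; apply/hull_inP => a c b aW cW ab bc.
  have nV x : x \in W -> x \notin V.
    move=> xW; apply/negP => xV; case/eqP: WV.
    case/and3P: pA => _ tr _.
    exact: etrans (esym (def_pblock tr Wpi xW)) (def_pblock tr Vpi xV).
  rewrite inE (hull_inP _ _ (hpi W Wpi) a c) // andbT.
  (* an element of V between a and c would make m, a, b, c a crossing *)
  apply/negP => bV.
  apply: (noncrossingP _ ncr V W m a b c) => //; first by rewrite eq_sym.
  apply: hm; last by apply: contraNneq (nV a aW) => ->.
  rewrite -(cover_partition pA); apply/bigcupP; by exists W.
rewrite inE => /and3P[pA ncr /forall_inP hpi].
have VpiN := notin pi pA.
have pU : partition (V |: pi) A.
  rewrite -[A](setID _ V) (setIidPr VA); apply: partitionU1 => //.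
  by rewrite disjoint_subset; apply/subsetP => x xV; rewrite !inE xV.
rewrite inE pU setU1K // eqxx andbT /=; apply/andP; split; last first.
  apply/eqP/def_pblock => //; rewrite ?setU11 //.
  by case/and3P: pU.
apply/andP; split.
  apply/noncrossingP => B B' a b c d /setU1P[->|h1] /setU1P[->|h2] ne.
  - by rewrite eqxx in ne.
  - move=> aV bB' cV dB' ab bc cd.
    have := hull_inP _ _ (hpi B' h2) b d c bB' dB' bc cd.
    by rewrite inE cV.
  - move=> aB bV cB dV ab bc cd.
    have := hull_inP _ _ (hpi B h1) a c b aB cB ab bc.
    by rewrite inE bV.
  - exact: (noncrossingP _ ncr).
apply/forall_inP => W /setU1P[-> //|Wpi].
apply/hull_inP => a c b aW cW ab bc.
by have /setDP[] := hull_inP _ _ (hpi W Wpi) a c b aW cW ab bc.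
Qed.

(** The block of the minimum of the union lies in the part containing this
minimum, so the recursion for the union is that for this part times the sum
for the other. *)
Lemma nc_sumU A B : separated A B -> nc_sum (A :|: B) = nc_sum A * nc_sum B.
Proof.
have [n] := ubnP #|A :|: B|; elim: n A B => // n IH A B leAB sep.
have [/eqP|/is_min_exists[m hm]] := eqVneq (A :|: B) set0.
  by rewrite setU_eq0 => /andP[/eqP-> /eqP->]; rewrite setU0 nc_sum0 mul1r.
wlog mA : A B leAB sep hm / m \in A.
  move=> hw; have [mAB _] := is_minP hm.
  case/setUP: (mAB) => [mA|mB]; first exact: hw.
  rewrite setUC mulrC; apply: hw; rewrite 1?setUC // => a b aB bA.
  have [z zn zb] := sep b a bA aB; exists z; first by rewrite setUC.
  by rewrite orbC.
have [_ min_m] := is_minP hm.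
have hmA : is_min A m.
  apply/andP; split=> //; apply/forall_inP => j jA.
  by case: eqVneq => //= jm; apply: min_m; rewrite // inE jA.
rewrite (nc_sum_rec hm) (nc_sum_rec hmA) big_distrl /=.
(* a hull starting in A and reaching B would meet a separating point *)
have in_A b : b \in A :|: B -> (forall z, lt m z -> lt z b -> z \in A :|: B) ->
    b \in A.
  case/setUP=> // bB h; have [z zn] := sep m b mA bB.
  case/orP=> /andP[h1 h2]; first by rewrite h in zn.
  case: (eqVneq b m) => [->//|bm].
  have mb : lt m b by apply: min_m; rewrite // inE bB orbT.
  by have := slt_trans (slt_trans mb h1) h2; rewrite slt_irr.
apply: eq_big => [V | V /and3P[mV VAB hV]].
  case mV: (m \in V) => //=; apply/andP/andP => -[VA /hull_inP hV]; last first.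
    split; first by rewrite subsetU ?VA.
    by apply/hull_inP => a c b aV cV ab bc; rewrite inE (hV a c).
  have VA' : V \subset A.
    apply/subsetP => b bV; apply: in_A; first exact: (subsetP VA).
    by move=> z; apply: hV.
  split=> //; apply/hull_inP => a c b aV cV ab bc.
  apply: in_A; first exact: (hV a c).
  move=> z mz zb; apply: (hV m c) => //; exact: slt_trans bc.
have dVB : [disjoint V & B].
  rewrite disjoint_subset; apply/subsetP => b bV; apply/negP => bB.
  have bA : b \in A.
    apply: in_A; first exact: (subsetP VAB).
    by move=> z; apply: (hull_inP _ _ hV).
  have [z zn] := sep b b bA bB; rewrite orbb => /andP[h1 h2].
  by have := slt_trans h1 h2; rewrite slt_irr.
have -> : (A :|: B) :\: V = (A :\: V) :|: B.
  by rewrite setDUl; congr (_ :|: _); apply/setDidPl; rewrite disjoint_sym.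
rewrite IH ?mulrA //.
  rewrite ltnS in leAB; apply: leq_trans leAB.
  apply: proper_card; apply/properP; split.
    by apply: setSU; apply: subsetDl.
  exists m; first by rewrite inE mA.
  by rewrite !inE mV (disjointFr dVB mV).
move=> a b /setDP[aA _] bB; have [z zn zb] := sep a b aA bB; exists z => //.
by apply: contra zn; rewrite !inE => /orP[/andP[_ ->]|->]; rewrite ?orbT.
Qed.

Lemma nc_sum_intervals A : nc_sum A = \prod_(J in intervals A) nc_sum J.
Proof.
have pA := intervals_partition A.
suff main (P : {set {set T}}) : P \subset intervals A ->
    nc_sum (cover P) = \prod_(J in P) nc_sum J.
  by rewrite -{1}(cover_partition pA) main.
have [n] := ubnP #|P|; elim: n P => // n IH P leP sP.
have [->|[J JP]] := set_0Vmem P.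
  by rewrite /cover !big_set0 nc_sum0.
have sP' : P :\ J \subset intervals A.
  by apply: subset_trans sP; apply: subD1set.
rewrite (big_setD1 J) //= -IH //; last by rewrite (cardsD1 J) JP in leP.
rewrite {1}/cover (big_setD1 J) //= nc_sumU //.
move=> a b aJ /bigcupP[J' /setD1P[ne J'P] bJ'].
have : ~~ connected_in A a b.
  apply/negP.
  move/(intervals_connected (subsetP sP _ JP) (subsetP sP _ J'P) aJ bJ').
  by move/esym/eqP; rewrite (negPf ne).
rewrite negb_forall => /existsP[z]; rewrite negb_imply => /andP[zb zA].
exists z => //; apply: contra zA => zU; rewrite -(cover_partition pA).
case/setUP: zU => [zJ|/bigcupP[L /setD1P[_ LP] zL]]; apply/bigcupP.
  by exists J => //; apply: (subsetP sP).
by exists L => //; apply: (subsetP sP).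
Qed.

End Sum.

End Order.

(** Invariance under an increasing injection whose range is convex. Weights are
only compared on subsets of [A], since turning a variable into a placeholder
changes the weights of the other subsets. *)
Lemma nc_sum_transport (T T' : finType) (lt : rel T) (lt' : rel T')
    (K : comNzRingType) (kappa : {set T} -> K) (kappa' : {set T'} -> K)
    (phi : T' -> T) (A : {set T'}) :
  strict_total lt -> strict_total lt' -> injective phi ->
  (forall x y, lt' x y = lt (phi x) (phi y)) ->
  (forall a c b, lt (phi a) b -> lt b (phi c) -> b \in codom phi) ->
  (forall V : {set T'}, V \subset A -> kappa' V = kappa (phi @: V)) ->
  nc_sum lt' kappa' A = nc_sum lt kappa (phi @: A).
Proof.
move=> lt_tot lt_tot' inj mono conv.
have [n] := ubnP #|A|; elim: n A => // n IH A leA hk.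
have [->|/(is_min_exists lt_tot')[m hm]] := eqVneq A set0.
  by rewrite imset0 !nc_sum0.
have [mA min_m] := is_minP hm.
have hm' : is_min lt (phi @: A) (phi m).
  apply/andP; split; first exact: imset_f.
  apply/forall_inP => _ /imsetP[j jA ->]; rewrite inj_eq // -mono.
  by case: eqVneq => //= jm; apply: min_m.
have imsub (V : {set T'}) : (phi @: V \subset phi @: A) = (V \subset A).
  apply/idP/idP => [h|]; last exact: imsetS.
  by apply/subsetP => x xV; rewrite -(mem_imset _ _ inj) (subsetP h) ?imset_f.
rewrite (nc_sum_rec _ hm) (nc_sum_rec _ hm').
rewrite (reindex_onto (fun V : {set T'} => phi @: V)
                      (fun V : {set T} => phi @^-1: V)) /=; last first.
  move=> V /and3P[_ VA _]; apply/setP => x; apply/imsetP/idP => [[y]|xV].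
    by rewrite inE => yV ->.
  have /imsetP[y _ e] := subsetP VA x xV; exists y => //.
  by rewrite inE -e.
apply: eq_big => [V | V /and3P[mV VA _]].
  have -> : phi @^-1: (phi @: V) == V.
    by apply/eqP/setP => x; rewrite inE mem_imset.
  rewrite andbT mem_imset // imsub.
  congr [&& _, _ & _]; apply/hull_inP/hull_inP => h.
    move=> _ _ b /imsetP[a aV ->] /imsetP[c cV ->] ab bc.
    have /codomP[b' e] := conv a c b ab bc; rewrite e in ab bc *.
    by rewrite imset_f // (h a c) // mono.
  move=> a c b aV cV ab bc; rewrite -(mem_imset _ _ inj).
  by apply: (h (phi a) (phi c)); rewrite ?imset_f -?mono.
have -> : phi @: A :\: phi @: V = phi @: (A :\: V).
  apply/setP => x; apply/idP/imsetP => [/setDP[/imsetP[y yA ->]]|[y]].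
    by rewrite mem_imset // => yV; exists y => //; rewrite inE yV.
  by case/setDP=> yA yV ->; rewrite inE !mem_imset // yA yV.
rewrite hk // IH //.
  rewrite ltnS in leA; apply: leq_trans leA; apply: proper_card; apply/properP.
  by split; [apply: subsetDl | exists m => //; rewrite inE mV].
move=> W WA; apply: hk; exact: subset_trans WA (subsetDl _ _).
Qed.

(** * The necklace order and shaded bipartitions *)

Lemma necklace_strict_total (t : translucent_word) :
  strict_total (@necklace_lt t).
Proof.
rewrite /necklace_lt; split=> [i | j i l | i j].
- by case: (alpha i); rewrite ltnn.
- case: (alpha i); case: (alpha j); case: (alpha l) => //.
    exact: ltn_trans.
  by move=> h1 h2; apply: ltn_trans h1.
- rewrite -val_eqE /= neq_ltn => /orP[] h.
    by case: (alpha i); case: (alpha j); rewrite ?h ?orbT.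
  by case: (alpha i); case: (alpha j); rewrite ?h ?orbT.
Qed.

(** Let [m] be the first placeholder for the natural order. The positions before
[m] on its side are those preceding all placeholders in the necklace order if
[m] is on the left, and those following all of them if [m] is on the right. A
block with a placeholder in its hull that does not cross the placeholders has
points of both kinds, which shadedness forbids. *)
Lemma shaded_nc_bipartitionsE (t : translucent_word) :
  shaded_nc_bipartitions t = interval_nc (@necklace_lt t) (ones t).
Proof.
apply/setP => pi; rewrite !inE /incomplete_nc_bipartition.
case pA: (partition pi (ones t)) => //=.
have tr : trivIset pi by case/and3P: pA.
have inones V i : V \in pi -> i \in V -> i \in ones t.
  by move=> Vpi iV; rewrite -(cover_partition pA); apply/bigcupP; exists V.
have zones (i : 'I_(size t)) : i \in zeros t -> i \in ones t -> False.
  by rewrite !inE => /negP.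
set P := if _ then _ else _.
have P_cases B : B \in P -> B = zeros t \/ B \in pi.
  by rewrite /P; case: ifP => _; [right | case/setU1P; [left | right]].
have piP V : V \in pi -> V \in P.
  by rewrite /P; case: ifP => _ // Vpi; rewrite inE Vpi orbT.
apply/andP/andP => [[ncr sh] | [ncr /forall_inP hpi]].
  have ncrP := noncrossingP (@necklace_lt t) P ncr.
  split.
    apply/noncrossingP => B B' a b c d /piP BP /piP B'P; exact: ncrP.
  apply/forall_inP => V Vpi; apply/hull_inP => a c b aV cV ab bc.
  rewrite inE; apply/negPn/negP => zb.
  have bZ : b \in zeros t by rewrite inE.
  case: (arg_minnP (fun i : 'I_(size t) => val i) bZ) => m mZ hm.
  have mmin : is_min_zero m by apply/andP; split=> //; apply/forall_inP.
  have ZP : zeros t \in P.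
    have Z0 : zeros t != set0 by apply/set0Pn; exists b.
    by rewrite /P (negPf Z0) setU11.
  have VZ : V != zeros t.
    by apply/eqP => e; apply: (zones a); rewrite -?e // (inones V).
  have ne x : x \in V -> (x : nat) != m.
    move=> xV; rewrite val_eqE; apply/eqP => e.
    by apply: (zones m) => //; rewrite -e (inones V).
  have shade x y : x \in V -> y \in V -> (x < m)%N -> alpha x = alpha m ->
      (y < m)%N /\ alpha y = alpha m.
    move=> xV yV xm am.
    move: sh => /forallP/(_ m)/implyP/(_ mmin)/forallP/(_ x)/implyP.
    rewrite xm am eqxx => /(_ isT)/forall_inP/(_ y).
    by rewrite (def_pblock tr Vpi xV) yV => /(_ isT)/andP[-> /eqP].
  have bm := hm b bZ; have mP := piP V Vpi.
  case am: (alpha m).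
    (* the first interval of ones consists of the L-positions before m *)
    have [alt aa] : (a < m)%N /\ alpha a = alpha m.
      have : ~~ necklace_lt m a.
        apply/negP => ma.
        by apply: (ncrP _ _ m a b c ZP mP _ mZ aV bZ cV) => //; rewrite eq_sym.
      rewrite /necklace_lt am; case: (alpha a) => //.
      by rewrite -leqNgt leq_eqVlt (negPf (ne a aV)).
    have [cm ac] := shade a c aV cV alt aa.
    move: bc; rewrite /necklace_lt ac am; case: (alpha b) => // bc.
    by have := leq_trans (ltn_trans bc cm) bm; rewrite ltnn.
  (* the last interval of ones consists of the R-positions before m *)
  have [clt cc] : (c < m)%N /\ alpha c = alpha m.
    have : ~~ necklace_lt c m.
      apply/negP => cm.
      exact: (ncrP _ _ a b c m mP ZP).
    rewrite /necklace_lt am; case: (alpha c) => //.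
    by rewrite -leqNgt leq_eqVlt (negPf (ne c cV)).
  have [am' aa] := shade c a cV aV clt cc.
  move: ab; rewrite /necklace_lt aa am; case: (alpha b) => // ab.
  by have := leq_trans (ltn_trans ab am') bm; rewrite ltnn.
have hull V a c b Vpi aV cV ab bc :=
  hull_inP _ _ _ (hpi V Vpi) a c b aV cV ab bc.
split.
  apply: (introT (noncrossingP (@necklace_lt t) P)).
  move=> B B' a b c d /P_cases[->|h1] /P_cases[->|h2] ne.
  - by rewrite eqxx in ne.
  - by move=> aB bB cB dB ab bc cd; apply: (zones c cB); apply: (hull B' b d).
  - by move=> aB bB cB dB ab bc cd; apply: (zones b bB); apply: (hull B a c).
  - exact: (noncrossingP _ _ ncr).
apply/forallP => m; apply/implyP => /andP[mZ /forall_inP hm].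
apply/forallP => i; apply/implyP => /andP[im /eqP ai].
have iones : i \in ones t.
  rewrite inE; apply/negPn/negP => zi; have := hm i; rewrite inE => /(_ zi).
  by rewrite leqNgt im.
have icov : i \in cover pi by rewrite (cover_partition pA).
have Vpi : pblock pi i \in pi by rewrite pblock_mem.
apply/forall_inP => j jV; have iV : i \in pblock pi i by rewrite mem_pblock.
have h1 : ~~ (necklace_lt i m && necklace_lt m j).
  apply/negP => /andP[h1 h2]; apply: (zones m mZ).
  exact: (hull (pblock pi i) i j).
have h2 : ~~ (necklace_lt j m && necklace_lt m i).
  apply/negP => /andP[h3 h4]; apply: (zones m mZ).
  exact: (hull (pblock pi i) j i).
have ne : (j : nat) != m.
  rewrite val_eqE; apply/eqP => e.
  by apply: (zones m) => //; rewrite -e (inones _ _ Vpi).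
move: h1 h2; rewrite /necklace_lt ai.
case: (alpha m); case: (alpha j); rewrite ?im ?andbT //=.
  by move=> h _; move: h; rewrite -leqNgt leq_eqVlt (negPf ne).
by move=> _; rewrite -leqNgt leq_eqVlt (negPf ne).
Qed.

(** * Positions of words, of subwords and of translucidations *)

Section WordPositions.

Variables SL SR : Type.
Local Notation word := (incomplete_word SL SR).
Implicit Types w v : word.

(** The letter of [w] at a position given as a natural number, which is
independent of the type of positions; it is only meaningful within bounds. *)
Definition letter_at w (i : nat) : letter SL SR :=
  nth (Placeholder SL SR Left) w i.

Lemma size_word_type w : size (word_type w) = size w.
Proof. by rewrite size_map. Qed.

Lemma letter_typeE w (i : positions w) :
  (alpha i, bit i) = letter_type (letter_at w i).
Proof.
rewrite /alpha /bit (tnth_nth (Left, false)) /= -surjective_pairing.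
by rewrite (nth_map (Placeholder SL SR Left)) // -size_word_type.
Qed.

Lemma alphaE w (i : positions w) : alpha i = (letter_type (letter_at w i)).1.
Proof. by rewrite -letter_typeE. Qed.

Lemma bitE w (i : positions w) : bit i = (letter_type (letter_at w i)).2.
Proof. by rewrite -letter_typeE. Qed.

Lemma placeholder_wordE w : placeholder_word w = (word_ones w == set0).
Proof.
apply/(all_nthP (Placeholder SL SR Left))/eqP => [h | h i iw].
  apply/setP => i; rewrite !inE bitE; apply/negbTE/h.
  by rewrite -size_word_type.
rewrite -size_word_type in iw.
have : (Ordinal iw : positions w) \notin word_ones w by rewrite h inE.
by rewrite inE bitE.
Qed.

Lemma subwordE n (V : {set 'I_n}) w : size w = n ->
  subword V w = [seq letter_at w i | i : 'I_n <- enum V].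
Proof.
move=> sw; rewrite /subword /indicator.
have {1}-> : w = [seq letter_at w i | i : 'I_n <- enum 'I_n].
  rewrite (map_comp (letter_at w) val) val_enum_ord -sw.
  by rewrite -/(mkseq _ _) mkseq_nth.
rewrite -map_mask -filter_mask; congr map.
by rewrite enumT.
Qed.

Lemma sorted_enum_ord n (V : {set 'I_n}) : sorted (relpre val ltn) (enum V).
Proof.
have -> : enum V = [seq i <- enum 'I_n | i \in V] by rewrite enumT.
apply: sorted_filter; first by move=> j i l; apply: ltn_trans.
by rewrite -sorted_map val_enum_ord iota_ltn_sorted.
Qed.

Lemma enum_imset_ord n n' (phi : 'I_n' -> 'I_n) (V : {set 'I_n'}) :
  {homo phi : i j / (i < j)%N} -> enum (phi @: V) = [seq phi i | i <- enum V].
Proof.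
move=> homo; apply: (@irr_sorted_eq _ (relpre val ltn)).
- by move=> j i l; apply: ltn_trans.
- by move=> i; apply: ltnn.
- exact: sorted_enum_ord.
- rewrite sorted_map; apply: sub_sorted (sorted_enum_ord V) => i j; exact: homo.
- move=> i; rewrite mem_enum; apply/imsetP/mapP => -[j jV ->]; exists j => //.
    by rewrite mem_enum.
  by rewrite mem_enum in jV.
Qed.

Lemma subword_imset n n' (phi : 'I_n' -> 'I_n) (V : {set 'I_n'}) v w :
  size v = n' -> size w = n -> {homo phi : i j / (i < j)%N} ->
  (forall i : 'I_n', i \in V -> letter_at v i = letter_at w (phi i)) ->
  subword V v = subword (phi @: V) w.
Proof.
move=> sv sw homo h; rewrite !subwordE // enum_imset_ord // -map_comp.
by apply/eq_in_map => i; rewrite mem_enum => /h.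
Qed.

Lemma subwordT w : subword [set: positions w] w = w.
Proof.
rewrite subwordE ?size_word_type // enum_setT -enumT.
rewrite (map_comp (letter_at w) val) val_enum_ord.
by rewrite -/(mkseq _ _) mkseq_nth.
Qed.

(** The inclusion of the positions of [w|_I] into those of [w]. *)
Lemma subword_embedding w (I : {set positions w}) :
  exists phi : positions (subword I w) -> positions w,
    [/\ {homo phi : i j / (i < j)%N}, codom phi =i I
      & forall i : positions (subword I w),
          letter_at (subword I w) i = letter_at w (phi i)].
Proof.
have sI : size (word_type (subword I w)) = #|I|.
  by rewrite size_word_type subwordE ?size_word_type // size_map -cardE.
exists (fun i => enum_val (cast_ord sI i)); split.
- move=> i j ij; have d : positions w := enum_val (cast_ord sI i).
  rewrite !(enum_val_nth d).
  apply: (sorted_ltn_nth (leT := relpre val ltn)) (sorted_enum_ord I) _ _ _ _ _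
    => //.
  + by move=> y x z; apply: ltn_trans.
  + by rewrite inE -cardE.
  + by rewrite inE -cardE.
- move=> y; apply/codomP/idP => [[i ->]|yI]; first exact: enum_valP.
  exists (cast_ord (esym sI) (enum_rank_in yI y)).
  by rewrite cast_ordKV enum_rankK_in.
- move=> i; rewrite {1}subwordE ?size_word_type // {1}/letter_at.
  have iI : (i < size (enum I))%N by rewrite -cardE -sI.
  have d : positions w := enum_val (cast_ord sI i).
  by rewrite (nth_map d) // (enum_val_nth d).
Qed.

(** The identification of the positions of a translucidation of [w] with those
of [w]; the two types differ, although they are both ordinals of the same
size. *)
Lemma translucidate_embedding w (I : {set positions w}) :
  exists phi : positions (translucidate I w) -> positions w,
    [/\ {homo phi : i j / (i < j)%N}, forall j, j \in codom phi
      & forall i : positions (translucidate I w),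
          letter_at (translucidate I w) i =
          if phi i \in I then Placeholder SL SR (alpha (phi i))
          else letter_at w (phi i)].
Proof.
have si : size (indicator I) = size w.
  by rewrite size_map size_enum_ord size_word_type.
have sI : size (word_type (translucidate I w)) = size (word_type w).
  by rewrite !size_word_type size_map size_zip si minnn size_word_type.
exists (cast_ord sI); split=> // [j | i].
  by apply/codomP; exists (cast_ord (esym sI) j); rewrite cast_ordKV.
set j := cast_ord sI i; have -> : (i : nat) = j by [].
have jw : (j < size w)%N by rewrite -size_word_type.
clearbody j.
rewrite /letter_at (nth_map (false, Placeholder SL SR Left)); last first.
  by rewrite size_zip si minnn.
rewrite nth_zip //= /indicator (nth_map j) ?size_enum_ord //.
by rewrite nth_ord_enum -/(letter_at w j) -alphaE.
Qed.

Lemma necklace_embedding v w (phi : positions v -> positions w) :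
  {homo phi : i j / (i < j)%N} -> (forall i, alpha (phi i) = alpha i) ->
  injective phi /\ forall i j, necklace_lt i j = necklace_lt (phi i) (phi j).
Proof.
move=> homo al.
have mono i j : (phi i < phi j)%N = (i < j)%N.
  apply/idP/idP; last exact: homo.
  rewrite !ltnNge (leq_eqVlt j); apply: contra => /orP[/eqP/val_inj-> //|].
  by move/homo/ltnW.
split=> [i j e | i j]; last by rewrite /necklace_lt !al !mono.
by apply: val_inj; case: (ltngtP i j) => // /homo; rewrite e ltnn.
Qed.

End WordPositions.

(** * The solution of the fixed point equation *)

Section Solution.

Variables (SL SR : Type) (K : comNzRingType) (k : linear_form SL SR K).
Local Notation word := (incomplete_word SL SR).
Implicit Types w v : word.

(** The solution M, as a sum over partitions of the variables of the word. *)
Definition moment : linear_form SL SR K := fun w =>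
  nc_sum (@necklace_lt (word_type w)) (fun V => k (subword V w)) (word_ones w).

Lemma moment_embedding v w (phi : positions v -> positions w) :
  {homo phi : i j / (i < j)%N} -> (forall i, alpha (phi i) = alpha i) ->
  (forall i : positions v, i \in word_ones v ->
     letter_at v i = letter_at w (phi i)) ->
  (forall a c b, necklace_lt (phi a) b -> necklace_lt b (phi c) ->
     b \in codom phi) ->
  moment v = nc_sum (@necklace_lt (word_type w)) (fun V => k (subword V w))
               (phi @: word_ones v).
Proof.
move=> homo al hl conv; have [inj mono] := necklace_embedding homo al.
apply: nc_sum_transport => //; try exact: necklace_strict_total.
move=> V /subsetP sV.
rewrite (@subword_imset _ _ _ _ phi V v w) ?size_word_type //.
by move=> i /sV; apply: hl.
Qed.

Lemma moment_subword w (J : {set positions w}) :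
  J \subset word_ones w -> hull_in (@necklace_lt (word_type w)) J J ->
  moment (subword J w) =
    nc_sum (@necklace_lt (word_type w)) (fun V => k (subword V w)) J.
Proof.
move=> JO hJ; have [phi [homo im hl]] := subword_embedding J.
have al i : alpha (phi i) = alpha i by rewrite !alphaE hl.
rewrite (moment_embedding homo al) => [|i _|a c b ab bc] //.
  congr nc_sum; apply/setP => j; rewrite -im.
  apply/imsetP/codomP => [[i _ ->]|[i ->]]; exists i => //.
  rewrite inE bitE hl -bitE.
  have : phi i \in word_ones w by rewrite (subsetP JO) // -im codom_f.
  by rewrite inE.
by rewrite im (hull_inP _ _ _ hJ (phi a) (phi c) b) // -im codom_f.
Qed.

Lemma word_ones_translucidate w (I : {set positions w}) :
  exists phi : positions (translucidate I w) -> positions w,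
    [/\ {homo phi : i j / (i < j)%N}, forall j, j \in codom phi,
        forall i, alpha (phi i) = alpha i,
        forall i : positions (translucidate I w),
          i \in word_ones (translucidate I w) ->
          letter_at (translucidate I w) i = letter_at w (phi i)
      & phi @: word_ones (translucidate I w) = word_ones w :\: I].
Proof.
have [phi [homo im hl]] := translucidate_embedding I; exists phi.
have ho i : (i \in word_ones (translucidate I w)) =
    (phi i \notin I) && (phi i \in word_ones w).
  by rewrite !inE !bitE hl; case: ifP.
split=> //.
- by move=> i; rewrite [in RHS]alphaE hl; case: ifP => _ //; rewrite alphaE.
- by move=> i; rewrite ho hl => /andP[/negPf-> _].
apply/setP => j; have /codomP[i ->] := im j.
have inj : injective phi.
  move=> x y e; apply: val_inj.
  by case: (ltngtP x y) => // /homo; rewrite e ltnn.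
by rewrite mem_imset // ho in_setD.
Qed.

Lemma moment_translucidate w (I : {set positions w}) :
  moment (translucidate I w) =
    nc_sum (@necklace_lt (word_type w)) (fun V => k (subword V w))
      (word_ones w :\: I).
Proof.
have [phi [homo im al hl <-]] := word_ones_translucidate I.
by apply: moment_embedding.
Qed.

Lemma card_ones_translucidate w (I : {set positions w}) :
  #|word_ones (translucidate I w)| = #|word_ones w :\: I|.
Proof.
have [phi [homo im al hl <-]] := word_ones_translucidate I.
by rewrite card_imset //; case: (necklace_embedding homo al).
Qed.

Lemma moment_in_MI : in_MI moment.
Proof.
move=> w; rewrite {1}/moment.
rewrite (nc_sum_intervals (necklace_strict_total (word_type w))).
apply: eq_bigr => J; rewrite inE => /maxsetp /and3P[_ hJ JO].
by rewrite moment_subword.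
Qed.

Lemma moment_placeholder w : placeholder_word w -> moment w = 1.
Proof. by rewrite placeholder_wordE => /eqP e; rewrite /moment e nc_sum0. Qed.

Hypothesis hk : in_mI k.

Lemma in_mI_placeholder w : placeholder_word w -> k w = 0.
Proof.
rewrite placeholder_wordE => /eqP e; apply: hk.1 => /eqP.
rewrite (card_intervals1 (necklace_strict_total (word_type w))).
by rewrite -/(word_ones w) e eqxx.
Qed.

(** The values of [k] that occur as left factors in the half-shuffle product:
only the variables of [w] in [I] matter, and no placeholder of [w] may separate
two of them in the necklace order. *)
Lemma in_mI_subword w (I : {set positions w}) : word_zeros w \subset I ->
  k (subword I w) =
    if (I :&: word_ones w != set0) &&
       hull_in (@necklace_lt (word_type w)) (word_ones w) (I :&: word_ones w)
    then k (subword (I :&: word_ones w) w) else 0.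
Proof.
move=> ZI; set v := subword I w.
have [phi [homo im hl]] := subword_embedding I.
have al i : alpha (phi i) = alpha i by rewrite !alphaE hl.
have [inj mono] := necklace_embedding homo al.
have ho i : (phi i \in word_ones w) = (i \in word_ones v).
  by rewrite !inE !bitE hl.
have imO : phi @: word_ones v = I :&: word_ones w.
  apply/setP => j; rewrite !inE -im; apply/imsetP/andP => [[i iO ->]|].
    by rewrite codom_f; split=> //; rewrite -ho inE in iO.
  by case=> /codomP[i ->] h; exists i => //; rewrite -ho inE.
have eO : (I :&: word_ones w != set0) = (word_ones v != set0).
  by rewrite -imO imset_eq0.
have eH : hull_in (@necklace_lt (word_type w)) (word_ones w) (I :&: word_ones w)
    = hull_in (@necklace_lt (word_type v)) (word_ones v) (word_ones v).
  rewrite -imO; apply/hull_inP/hull_inP => h.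
    move=> a c b aO cO ab bc; rewrite -ho; apply: (h (phi a) (phi c)).
    - exact: imset_f.
    - exact: imset_f.
    - by rewrite -mono.
    - by rewrite -mono.
  move=> _ _ b /imsetP[a aO ->] /imsetP[c cO ->] ab bc.
  case bO: (b \in word_ones w) => //.
  have bI : b \in I by apply: (subsetP ZI); move: bO; rewrite !inE => ->.
  move: bI ab bc bO; rewrite -im => /codomP[b' ->].
  rewrite -(mono a b') -(mono b' c) ho => ab bc.
  by rewrite (h a c b').
rewrite eO eH -(card_intervals1 (necklace_strict_total (word_type v))).
case: eqP => c1; last exact: hk.1.
rewrite hk.2 // -imO; congr k; apply: subword_imset; rewrite ?size_word_type //.
Qed.

Lemma moment_half_shuffle : half_shuffle_solution k moment.
Proof.
split=> [w hw | w].
  by rewrite moment_placeholder // /epsilon hw subrr.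
rewrite /half_shuffle_unital /half_shuffle.
case hw: (placeholder_word w).
  rewrite moment_placeholder // /epsilon hw in_mI_placeholder // add0r.
  rewrite big1 ?addr0 // => I /and3P[_ _ /exists_inP[i _ /andP[]]].
  by move: hw; rewrite placeholder_wordE => /eqP->; rewrite inE.
have O0 : word_ones w != set0 by rewrite -placeholder_wordE hw.
have lt_tot := necklace_strict_total (word_type w).
have [m hm] := is_min_exists lt_tot O0.
have mO : m \in word_ones w by case/andP: hm.
rewrite {1}/epsilon hw add0r {1}/moment (nc_sum_rec _ hm).
(* The unital part k(w) is the term I = all positions of the sum over those I
   which contain the placeholders and m; such an I is determined by the set V
   of variables in it. *)
pose term (I : {set positions w}) :=
  k (subword I w) * moment (translucidate I w).
transitivity
  (\sum_(I : {set positions w} | (word_zeros w \subset I) && (m \in I)) term I).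
  rewrite [RHS](reindex_onto (fun V => word_zeros w :|: V)
             (fun I => I :&: word_ones w)) /=; last first.
    move=> I /andP[ZI _]; apply/setP => j; rewrite !inE.
    case: (boolP (bit j)) => [_|zj]; rewrite ?andbT //=.
    by rewrite (subsetP ZI) // inE.
  under eq_bigl => V do rewrite andbA.
  rewrite big_mkcondr /=; symmetry.
  apply: eq_big => [V | V].
    rewrite subsetUl inE [m \in word_zeros w]inE.
    move: (mO); rewrite inE => -> /=; congr (_ && _).
    apply/eqP/idP => [<- | VO]; first exact: subsetIr.
    apply/setP => j; rewrite !inE andb_orl andNb /=.
    apply/andP/idP => [[] // | jV]; split=> //.
    by have := subsetP VO j jV; rewrite inE.
  case/andP=> /andP[_ mV] /eqP eV.
  rewrite /term in_mI_subword ?subsetUl // eV moment_translucidate.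
  have mV' : m \in V by rewrite -eV inE mV.
  have -> : V != set0 by apply/set0Pn; exists m.
  rewrite /=; case: ifP => _; last by rewrite mul0r.
  congr (_ * nc_sum _ _ _); apply/setP => j; rewrite !inE.
  by case: (bit j); rewrite ?andbF.
rewrite (bigD1 [set: positions w]) ?subsetT ?inE //=.
rewrite {1}/term subwordT moment_translucidate setDT nc_sum0 mulr1.
congr (_ + _); apply: eq_big => [I | I /andP[/andP[ZI mI] IT]].
  have -> : [exists i in I, is_necklace_min (word_ones w) i] = (m \in I).
    apply/exists_inP/idP => [[i iI hi]|mI]; last by exists m.
    by rewrite -(is_min_unique lt_tot hi hm).
  rewrite !properE eqEsubset !subsetT /=.
  case mI: (m \in I); rewrite ?andbF //= !andbT.
  suff -> : I \subset word_zeros w = false by rewrite andbT.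
  by apply/negP => /subsetP/(_ m mI); move: mO; rewrite !inE => ->.
rewrite /term; congr (_ * _); rewrite /epsilon placeholder_wordE -cards_eq0.
rewrite card_ones_translucidate cards_eq0 setD_eq0.
suff -> : word_ones w \subset I = false by rewrite subr0.
apply/negbTE; apply: contra IT => OI; rewrite eqEsubset subsetT /=.
apply/subsetP => j _; case: (boolP (bit j)) => bj.
  by rewrite (subsetP OI) // inE.
by rewrite (subsetP ZI) // inE.
Qed.

Lemma half_shuffle_solution_unique M M' :
  half_shuffle_solution k M -> half_shuffle_solution k M' -> M =1 M'.
Proof.
move=> [_ hM] [_ hM'] w.
have [n] := ubnP #|word_ones w|; elim: n w => // n IH w lew.
rewrite hM hM'; congr (_ + (_ + _)); apply: eq_bigr => I /and3P[_ _ hI].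
rewrite IH //; rewrite ltnS in lew; apply: leq_trans lew.
rewrite card_ones_translucidate; apply: proper_card; apply/properP.
split; first exact: subsetDl.
by case/exists_inP: hI => i iI /andP[iO _]; exists i; rewrite // inE iI.
Qed.

End Solution.

Theorem theorem5p8 (R : realType) (A : algType R[i]) (AL AR : subalgClosed A)
    (SL SR : {fset A}) (hSL : {subset SL <= AL}) (hSR : {subset SR <= AR})
    (k : linear_form SL SR R[i]) (hk : in_mI k) :
  exists M : linear_form SL SR R[i],
    [/\ half_shuffle_solution k M,
        (forall M' : linear_form SL SR R[i],
           half_shuffle_solution k M' -> M' =1 M),
        in_MI M
      & forall (t : translucent_word) (w : incomplete_word SL SR),
          word_type w = t ->
          M w = \sum_(pi in shaded_nc_bipartitions t)
                  \prod_(V in pi) k (subword V w)].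
Proof.
have sol := moment_half_shuffle hk.
exists (moment k); split=> //.
- by move=> M' hM'; apply: half_shuffle_solution_unique hM' sol.
- exact: moment_in_MI.
- by move=> _ w <-; rewrite shaded_nc_bipartitionsE.
Qed.
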